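(* Let $\mathbf{T}=\frac{p}{q}$ be a rational 2-string tangle, with endpoint arcs ordered clockwise starting from the top left (NW, NE, SE, SW). Then $\mathbf{d_U(T)}=1$ and, up to row equivalence (via integer row operations), $$\mathbf{M_l(T)}=\begin{pmatrix}1 & -1 & 1 & -1\\ 0 & p & -p-q & q\end{pmatrix}.$$
   Context: Tangles. An $n$-string tangle is a 3-ball with $n$ strings (arcs) properly embedded in it, considered up to isotopy fixing the boundary. An arc of a tangle diagram is a maximal connected piece running between undercrossings and/or endpoints; an endpoint arc has an endpoint on the boundary, the other arcs are interior arcs. Fix an ordering of the $2n$ endpoints. Coloring matrix: assign a variable to each arc. If a string projects to a single arc, that arc is given two variables $x_i,x_j$, one for each of its endpoints, and the equation $x_i-x_j=0$ is added. Each crossing with overarc $x$ and underarcs $y,z$ gives the equation $y+z-2x=0$ (coefficients are added if arcs coincide). The integer coefficient matrix $\mathbf{M_T}$ of these equations has the interior-arc columns first and the $2n$ endpoint-arc columns last in the fixed order; with $k$ equations it is a $k\times(k+n)$ matrix. Allowed row operations: exchanging two rows, adding an integer multiple of one row to a different row, multiplying a row by $-1$. Row equivalent means related by these operations. The standard echelon form $SF(\mathbf{M_T})$ is the unique matrix row equivalent to $\mathbf{M_T}$ that is in echelon form, has positive leading entries, and in which every entry above a leading entry is nonnegative and strictly less than that leading entry. $\mathbf{d_U(T)}$ is the absolute value of the determinant of the upper left $(k-n)\times(k-n)$ submatrix of $SF(\mathbf{M_T})$ (equal to $1$ if $k=n$), and $\mathbf{M_l(T)}$ is the lower right $n\times 2n$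 submatrix of $SF(\mathbf{M_T})$; both are tangle invariants (given the ordering of endpoints). Rational tangles. Draw 3-string braids horizontally with positions $1,2,3$ numbered from top to bottom, braid words being read from left to right. The generator $\sigma_i$ is a single crossing between positions $i$ and $i+1$ in which the strand going, from left to right, from position $i+1$ to position $i$ is the overstrand; in $\sigma_i^{-1}$ the strand going from position $i$ to position $i+1$ is the overstrand. A rational 2-string tangle is a tangle $\langle c_1,\dots,c_h\rangle$ ($h$ odd, $c_i\in\mathbb{Z}$) obtained from the 3-string braid $\sigma_1^{-c_1}\sigma_2^{c_2}\sigma_1^{-c_3}\cdots\sigma_2^{c_{h-1}}\sigma_1^{-c_h}$ by connecting the left endpoints in positions $2$ and $3$ to each other with a crossingless arc. Its remaining four endpoints, in clockwise order NW, NE, SE, SW, are: the left endpoint in position $1$, then the right endpoints in positions $1$, $2$, $3$. (For example, $\langle 0\rangle$ consists of two horizontal strings joining NW to NE and SW to SE.) This tangle is denoted $\frac{p}{q}$, where $\frac{p}{q}=\frac{E[c_1,\dots,c_h]}{E[c_1,\dots,c_{h-1}]}=c_h+\frac{1}{c_{h-1}+\cdots+\frac{1}{c_1}}$ and $p,q$ are coprime integers (with $q=0$ allowed); the pair $(p,q)$ equals $(E[c_1,\dots,c_h],E[c_1,\dots,c_{h-1}])$ up to a common sign. Rational tangles are determined by this fraction. Here the Euler bracket $E[c_1,\dots,c_h]$ is the sum of all products obtained from $c_1\cdots c_h$ by omitting zero or more disjoint pairs of consecutive $c_i$'s, with $E[\,]=1$. *)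

(* Defs.v *)
From Stdlib Require Export Relation_Operators ClassicalEpsilon.
From mathcomp Require Export all_boot all_order all_algebra.

Set Implicit Arguments.
Unset Strict Implicit.
Unset Printing Implicit Defensive.

Import Order.TTheory GRing.Theory Num.Theory.
Local Open Scope ring_scope.

(* Combinatorial data of an n-string tangle diagram.  The drawing is cut at its
   crossings, and possibly at further points of the strings, into [piece]s.
   The pairs [over c] and [under c] consist of the piece entering and the piece
   leaving the crossing c along its overstrand, resp. its understrand; two
   pieces are [joined] when they meet at a cut point which is not a crossing.
   [endpoint] lists the pieces ending at the 2n ordered boundary points.
   Planarity is not recorded: the coloring matrix only depends on these data. *)
Record tangle_diagram (n : nat) := TangleDiagram {
  piece : finType;
  crossing : finType;
  over : crossing -> piece * piece;
  under : crossing -> piece * piece;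
  joined : rel piece;
  endpoint : 'I_(n.*2) -> piece }.

Section Arcs.
Variables (n : nat) (D : tangle_diagram n).

Definition adjacent : rel (piece D) := fun x y =>
  [|| joined x y, joined y x
    | [exists c : crossing D, (over c == (x, y)) || (over c == (y, x))]].

(* An arc is the set of its pieces. *)
Definition arc_of (x : piece D) : {set piece D} :=
  [set y | connect adjacent x y].

Definition endpoint_arc (e : 'I_(n.*2)) : {set piece D} :=
  arc_of (endpoint D e).

Definition interior_arcs : {set {set piece D}} :=
  [set arc_of x | x : piece D] :\: [set endpoint_arc e | e : 'I_(n.*2)].

(* Two distinct endpoints have the same endpoint arc exactly when they are the
   endpoints of a string that projects to a single arc. *)
Definition single_arc_string : predArgType :=
  {e : 'I_(n.*2) * 'I_(n.*2) |
     (e.1 < e.2)%N && (endpoint_arc e.1 == endpoint_arc e.2)}.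

Definition equation : finType := (crossing D + single_arc_string)%type.

(* Column j of the matrix stands for a variable assigned to the arc [arc j].
   There is one variable for each interior arc and one for each endpoint, so a
   string projecting to a single arc has two; when its arc takes part in a
   crossing, either of the two may be used in the equation of that crossing. *)
Definition is_equation_row (m k : nat) (arc : 'I_(m + n.*2) -> {set piece D})
    (M : 'M[int]_(k, m + n.*2)) (r : 'I_k) (eq : equation) : Prop :=
  match eq with
  | inl c => exists x y z : 'I_(m + n.*2),
      [/\ arc x = arc_of (over c).1,
          arc y = arc_of (under c).1,
          arc z = arc_of (under c).2
        & row r M = delta_mx 0 y + delta_mx 0 z - 2 *: delta_mx 0 x]
  | inr s =>
      row r M = delta_mx 0 (rshift m (val s).1) - delta_mx 0 (rshift m (val s).2)
  end.

(* The number k of equations is m + n, where m is the number of interior arcs.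
   The order of the equations and that of the interior arcs are arbitrary. *)
Definition is_coloring_matrix (m : nat) (M : 'M[int]_(m + n, m + n.*2)) : Prop :=
  exists (eq : 'I_(m + n) -> equation) (inner : 'I_m -> {set piece D}),
    [/\ bijective eq,
        injective inner,
        [set inner j | j : 'I_m] = interior_arcs
      & forall r, is_equation_row
          (fun j => match split j with
                    | inl j' => inner j'
                    | inr e => endpoint_arc e
                    end) M r (eq r)].

End Arcs.

Section RowReduction.
Variables (k l : nat).

Inductive row_operation (A : 'M[int]_(k, l)) : 'M[int]_(k, l) -> Prop :=
| RowSwap (i j : 'I_k) : row_operation A (xrow i j A)
| RowAdd (i j : 'I_k) (c : int) : i != j ->
    row_operation A (\matrix_(r, s) (if r == j then A r s + c * A i s else A r s))
| RowNeg (i : 'I_k) :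
    row_operation A (\matrix_(r, s) (if r == i then - A r s else A r s)).

Definition row_equivalent : 'M[int]_(k, l) -> 'M[int]_(k, l) -> Prop :=
  clos_refl_sym_trans _ row_operation.

Definition leading (A : 'M[int]_(k, l)) (i : 'I_k) (j : 'I_l) : Prop :=
  A i j != 0 /\ forall j' : 'I_l, (j' < j)%N -> A i j' = 0.

(* In particular no zero row lies above a nonzero row. *)
Definition echelon (A : 'M[int]_(k, l)) : Prop :=
  forall (i i' : 'I_k) (j' : 'I_l), (i < i')%N -> leading A i' j' ->
    exists2 j : 'I_l, (j < j')%N & leading A i j.

Definition is_standard_form (A S : 'M[int]_(k, l)) : Prop :=
  [/\ row_equivalent A S,
      echelon S,
      forall i j, leading S i j -> 0 < S i j
    & forall i j, leading S i j ->
        forall i' : 'I_k, (i' < i)%N -> 0 <= S i' j < S i j].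

(* The unique matrix satisfying [is_standard_form A]. *)
Definition standard_form (A : 'M[int]_(k, l)) : 'M[int]_(k, l) :=
  epsilon (inhabits 0) (is_standard_form A).

End RowReduction.

(* [d_U] and [M_l] of a tangle, computed from a coloring matrix with m = k - n
   interior columns. *)
Definition d_U (m n : nat) (M : 'M[int]_(m + n, m + n.*2)) : int :=
  `| \det (ulsubmx (standard_form M)) |.

Definition M_l (m n : nat) (M : 'M[int]_(m + n, m + n.*2)) : 'M[int]_(n, n.*2) :=
  drsubmx (standard_form M).

(* Letters of 3-string braid words: (i, true) is the generator with crossing
   between positions i and i + 1, positions being 0, 1, 2 from top to bottom,
   and (i, false) is its inverse. *)
Definition letter : Type := ('I_2 * bool)%type.

Definition braid_power (i : 'I_2) (z : int) : seq letter :=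
  nseq `|z|%N (i, 0 <= z).

(* The entry c_(j+1) of <c_1, ..., c_h> is [nth 0 cs j]. *)
Definition rational_word (cs : seq int) : seq letter :=
  flatten [seq if odd j then braid_power 1 (nth 0 cs j)
               else braid_power 0 (- nth 0 cs j) | j <- iota 0 (size cs)].

Section ClosedBraid.
Variable w : seq letter.

(* The piece (t, s) is the part of the braid in position s after the first t
   letters of w. *)
Definition braid_piece : finType := ('I_(size w).+1 * 'I_3)%type.

Definition before (t : 'I_(size w)) (s : 'I_3) : braid_piece :=
  (widen_ord (leqnSn _) t, s).
Definition after (t : 'I_(size w)) (s : 'I_3) : braid_piece :=
  (lift ord0 t, s).

Definition braid_letter (t : 'I_(size w)) : letter := tnth (in_tuple w) t.
Definition upper (t : 'I_(size w)) : 'I_3 := inord (braid_letter t).1.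
Definition lower (t : 'I_(size w)) : 'I_3 := inord (braid_letter t).1.+1.

Definition rising (t : 'I_(size w)) := (before t (lower t), after t (upper t)).
Definition falling (t : 'I_(size w)) := (before t (upper t), after t (lower t)).

Definition braid_over (t : 'I_(size w)) :=
  if (braid_letter t).2 then rising t else falling t.
Definition braid_under (t : 'I_(size w)) :=
  if (braid_letter t).2 then falling t else rising t.

(* Besides the strand not involved in a crossing, the cap connects the left
   endpoints in the middle and bottom positions. *)
Definition braid_joined : rel braid_piece := fun x y =>
  [exists t : 'I_(size w), exists s : 'I_3,
     [&& s != upper t, s != lower t, x == before t s & y == after t s]]
  || ((x == (ord0, inord 1)) && (y == (ord0, inord 2))).

(* NW, NE, SE, SW. *)
Definition braid_endpoint (e : 'I_(2.*2)) : braid_piece :=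
  if val e is s.+1 then (ord_max, inord s) else (ord0, ord0).

Definition closed_braid : tangle_diagram 2 :=
  TangleDiagram braid_over braid_under braid_joined braid_endpoint.

End ClosedBraid.

Definition rational_tangle (cs : seq int) : tangle_diagram 2 :=
  closed_braid (rational_word cs).

(* All sequences obtained from cs by omitting disjoint pairs of consecutive
   entries, one for each choice of the omitted pairs. *)
Fixpoint omissions (cs : seq int) : seq (seq int) :=
  match cs with
  | [::] => [:: [::]]
  | a :: cs1 => [seq a :: s | s <- omissions cs1] ++
                (if cs1 is _ :: cs2 then omissions cs2 else [::])
  end.

Definition euler_bracket (cs : seq int) : int :=
  \sum_(s <- omissions cs) \prod_(x <- s) x.

(* The equality of fractions is cross-multiplied, as denominators may be 0. *)
Definition is_fraction_of (cs : seq int) (p q : int) : Prop :=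
  coprimez p q /\
  p * euler_bracket (take (size cs).-1 cs) = q * euler_bracket cs.

(* Main.v *)
Require Import Defs.
From mathcomp Require Import all_boot all_order all_algebra.
From mathcomp Require Import perm zify ring.
Import Order.TTheory GRing.Theory Num.Theory.
Local Open Scope ring_scope.

(** The rows of a coloring matrix [M] span a sublattice of the free abelian
group on its columns; the quotient is the group of colors generated by the arcs
under the crossing relations [y + z = 2 x].  In a rational tangle this group is
read off from left to right along the braid: everything is determined by the
color [a] of the upper left endpoint and the color [b] of the cap, freely, and
since the relations are affine the color of an arc is [a + y (b - a)] for an
integer [y] ([piece_color]).  Hence the row lattice of [M] consists of the
vectors [v] with [\sum_j v_j = 0] and [\sum_j v_j y_j = 0]
([row_lattice_iff]): equation rows satisfy both conditions, and conversely every
column is congruent modulo the rows to a combination of the two initial ones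
([row_lattice_color]).

A power [z] of a braid generator adds [z] times the difference of the two colors
involved to both of them ([final_color_power]), so the differences of
consecutive colors obey the recursion of the Euler brackets.  With
[P = E(c_1, ..., c_h)] and [Q = E(c_1, ..., c_(h-1))] the endpoints NW, NE, SE,
SW get the integers [0, - P, Q - P, Q] ([final_color_rational]).  As [P] and [Q]
are coprime ([convergents_bezout]) the endpoint colors generate all colors, which
yields vectors of the lattice completing the identity in the interior columns;
the vectors of the lattice supported at the endpoints are spanned by the rows of
the matrix of the theorem ([tangle_matrix_kernel]).  So [M] has the same row
lattice as a block matrix [N] with blocks [1, B] over [0, T], where [T] is that
matrix.  The rows of [N] are independent, so the standard form of [M] is [U N]
with [U] invertible over the integers.  An echelon matrix vanishes below the
diagonal ([echelon_lower0]), hence [U] is block upper triangular, its diagonal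
blocks are invertible, and they give [d_U] and [M_l] ([standard_form_block]).
Two facts on integer matrices are needed for this: standard forms exist
([exists_standard_form]), and invertible matrices are products of elementary
ones ([row_equivalent_unit]).

A coloring matrix exists because there are as many equations as there should be
([card_equation]).  Every crossing starts exactly one new arc, so a braid with
[n] letters has [n + 2] arcs ([card_arcs]); no arc has three endpoints
([endpoint_arc_distinct]), so the number of endpoint arcs is 4 minus the number
of strings that project to a single arc. *)

Set Implicit Arguments.
Unset Strict Implicit.
Unset Printing Implicit Defensive.

(** * Integer row operations *)

Lemma row_addE k l (A : 'M[int]_(k, l)) i j c :
  \matrix_(r, s) (if r == j then A r s + c * A i s else A r s)
  = (1%:M + c *: delta_mx j i) *m A.
Proof.
apply/matrixP=> r s; rewrite mulmxDl mul1mx -scalemxAl !mxE (bigD1 i) //= !mxE.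
rewrite big1 => [|t /negPf nti]; last by rewrite mxE nti andbF mul0r.
by rewrite eqxx andbT addr0; case: (r == j); rewrite ?mul1r ?mul0r ?mulr0 ?addr0.
Qed.

Lemma row_negE k l (A : 'M[int]_(k, l)) i :
  \matrix_(r, s) (if r == i then - A r s else A r s)
  = (1%:M - 2 *: delta_mx i i) *m A.
Proof.
apply/matrixP=> r s; rewrite mulmxBl mul1mx -scalemxAl !mxE (bigD1 i) //= !mxE.
rewrite big1 => [|t /negPf nti]; last by rewrite mxE nti andbF mul0r.
by rewrite eqxx andbT addr0; case: eqP => [->|_] /=; ring.
Qed.

Lemma row_operation_sym k l (A B : 'M[int]_(k, l)) :
  row_operation A B -> row_operation B A.
Proof.
case=> [i j|i j c nij|i].
- have {2}-> : A = xrow i j (xrow i j A) by apply/matrixP=> a b; rewrite !mxE tpermK.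
  exact: RowSwap.
- set B' := (X in row_operation X _).
  have -> : A = \matrix_(r, s) (if r == j then B' r s + - c * B' i s else B' r s).
    apply/matrixP=> r s; rewrite !mxE (negPf nij).
    by case: eqP => // _; ring.
  exact: RowAdd.
- set B' := (X in row_operation X _).
  have -> : A = \matrix_(r, s) (if r == i then - B' r s else B' r s).
    by apply/matrixP=> r s; rewrite !mxE; case: eqP; rewrite ?opprK.
  exact: RowNeg.
Qed.

Lemma row_operation_mull k l (A B : 'M[int]_(k, l)) :
  row_operation A B -> exists W, B = W *m A.
Proof.
case=> [i j|i j c _|i]; first by exists (tperm_mx i j); rewrite xrowE.
- by eexists; apply: row_addE.
- by eexists; apply: row_negE.
Qed.

Lemma row_equivalent_mull k l (A B : 'M[int]_(k, l)) :
  row_equivalent A B -> exists W W', B = W *m A /\ A = W' *m B.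
Proof.
elim=> {A B} [A B AB|A|A B _ [W [W' [? ?]]]|A B C _ [W [W' [eB eA]]] _ [V [V' [eC eB']]]].
- have [W ?] := row_operation_mull AB.
  by have [W' ?] := row_operation_mull (row_operation_sym AB); exists W, W'.
- by exists 1%:M, 1%:M; rewrite mul1mx.
- by exists W', W.
- exists (V *m W), (W' *m V'); split; first by rewrite -mulmxA -eB.
  by rewrite -mulmxA -eB'.
Qed.

Lemma row_equivalent_mulr k l l' (A B : 'M[int]_(k, l)) (C : 'M_(l, l')) :
  row_equivalent A B -> row_equivalent (A *m C) (B *m C).
Proof.
elim=> {A B} [A B AB|A|A B _ AB|A B D _ AB _ BD].
- apply: rst_step; case: AB => [i j|i j c nij|i].
  + by rewrite !xrowE -mulmxA -xrowE; apply: RowSwap.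
  + by rewrite row_addE -mulmxA -row_addE; apply: RowAdd.
  + by rewrite row_negE -mulmxA -row_negE; apply: RowNeg.
- exact: rst_refl.
- exact: rst_sym.
- exact: rst_trans BD.
Qed.

Lemma row_equivalent_add_multiples k l (A : 'M[int]_(k, l)) (r : 'I_k) (f : 'I_k -> int) :
  f r = 0 -> row_equivalent A (\matrix_(i, j) (A i j + f i * A r j)).
Proof.
move=> fr0.
(* The rows are treated one at a time, from the top. *)
suff H n : row_equivalent A
    (\matrix_(i, j) (A i j + (if (i < n)%N then f i else 0) * A r j)).
  have -> : \matrix_(i, j) (A i j + f i * A r j)
     = \matrix_(i, j) (A i j + (if (i < k)%N then f i else 0) * A r j).
    by apply/matrixP=> i j; rewrite !mxE ltn_ord.
  exact: H.
elim: n => [|n IHn].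
  have {1}-> : A = \matrix_(i, j) (A i j + (if (i < 0)%N then f i else 0) * A r j).
    by apply/matrixP=> i j; rewrite !mxE mul0r addr0.
  exact: rst_refl.
apply: (rst_trans _ _ _ _ _ IHn).
set B := (X in clos_refl_sym_trans _ _ X _).
have BE (i : 'I_k) : (n == i -> i == r) -> forall j,
    B i j = A i j + (if (i < n.+1)%N then f i else 0) * A r j.
  move=> H j; rewrite mxE [in RHS]ltnS [in RHS]leq_eqVlt [(i : nat) == n]eq_sym.
  by case: eqP H => [_ /(_ isT)/eqP-> |//]; rewrite fr0 !if_same.
have [ltnk|lekn] := ltnP n k; last first.
  rewrite (_ : matrix_of_fun _ _ = B); first exact: rst_refl.
  apply/matrixP=> i j; rewrite BE ?mxE// => /eqP ni.
  by have := ltn_ord i; rewrite -ni ltnNge lekn.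
have [er|nr] := eqVneq (Ordinal ltnk) r.
  rewrite (_ : matrix_of_fun _ _ = B); first exact: rst_refl.
  apply/matrixP=> i j; rewrite BE ?mxE// => /eqP ni.
  by rewrite -er; apply/eqP/val_inj.
apply: rst_step.
rewrite (_ : matrix_of_fun _ _ = \matrix_(i, j)
   (if i == Ordinal ltnk then B i j + f (Ordinal ltnk) * B r j else B i j)).
  by apply: RowAdd; rewrite eq_sym.
apply/matrixP=> i j; rewrite 2!mxE; case: eqP => [->|ni].
  by rewrite !mxE fr0 /= ltnn ltnSn /=; case: ifP => _; ring.
by rewrite BE// => /eqP ni'; case: ni; apply: val_inj.
Qed.

(** The Euclidean algorithm on the entries of column [c] in the rows from [r] on.
The third clause says that columns vanishing in these rows are not disturbed. *)
Lemma row_equivalent_clear_column k l (A : 'M[int]_(k, l)) (r : 'I_k) (c : 'I_l) :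
  exists A' : 'M[int]_(k, l),
  [/\ row_equivalent A A',
      forall (i : 'I_k) j, (i < r)%N -> A' i j = A i j,
      forall j, (forall i : 'I_k, (r <= i)%N -> A i j = 0) ->
                 forall i : 'I_k, (r <= i)%N -> A' i j = 0,
      forall i : 'I_k, (r < i)%N -> A' i c = 0
    & 0 <= A' r c].
Proof.
(* Two nonzero entries allow a row addition decreasing the sum of the absolute
   values; once a single one is left, it is moved to row r. *)
have [n] := ubnP (\sum_(i : 'I_k | (r <= i)%N) `|A i c|%N).
elim: n A => // n IHn A; rewrite ltnS => leAn.
have [/existsP[i /existsP[i' /and5P[ri ri' nii' Ai0 leA]]]|] :=
  boolP [exists i : 'I_k, exists i' : 'I_k,
    [&& (r <= i)%N, (r <= i')%N, i != i', A i c != 0 & (`|A i c| <= `|A i' c|)%N]].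
  pose e : int := if (0 <= A i c) == (0 <= A i' c) then -1 else 1.
  pose B : 'M_(k, l) := \matrix_(a, b) (if a == i' then A a b + e * A i b else A a b).
  have AB : row_equivalent A B by apply/rst_step/RowAdd.
  have [] := IHn B.
    apply: leq_trans leAn; rewrite (bigD1 i')//= [ltnRHS](bigD1 i')//=.
    rewrite (eq_bigr (fun a => `|A a c|%N)); last first.
      by move=> a /andP[_ /negPf na]; rewrite mxE na.
    rewrite ltn_add2r mxE eqxx /e.
    by case: ifP; move: Ai0 leA; lia.
  move=> A' [BA' lo ze cl po]; exists A'; split=> //.
  - exact: rst_trans BA'.
  - move=> a b ar; rewrite lo// mxE; case: eqP => // ea.
    by move: ri'; rewrite -ea leqNgt ar.
  - move=> j Aj; apply: ze => a ra; rewrite mxE !Aj// mulr0 addr0.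
    by case: ifP.
move=> /existsPn noti.
have one (i i' : 'I_k) : (r <= i)%N -> (r <= i')%N -> i != i' -> A i c = 0 \/ A i' c = 0.
  move=> ri ri' nii'.
  have [->|Ai] := eqVneq (A i c) 0; first by left.
  have [->|Ai'] := eqVneq (A i' c) 0; first by right.
  have := noti i => /existsPn/(_ i'); have := noti i' => /existsPn/(_ i).
  rewrite ri ri' nii' eq_sym nii' Ai Ai' /=; lia.
have [i [ri one']] : exists i : 'I_k, (r <= i)%N /\
    forall i' : 'I_k, (r <= i')%N -> i' != i -> A i' c = 0.
  have [/existsP[i /andP[ri Ai]]|/existsPn no] :=
    boolP [exists i : 'I_k, (r <= i)%N && (A i c != 0)].
    exists i; split=> // i' ri' nii'.
    by have [//|] := one _ _ ri' ri nii' => E; rewrite E eqxx in Ai.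
  exists r; split=> // i' ri' _; have := no i'.
  by rewrite ri' /= negbK => /eqP.
pose B := xrow i r A.
have AB : row_equivalent A B by apply/rst_step/RowSwap.
have BE a b : B a b = A (if a == i then r else if a == r then i else a) b.
  rewrite mxE; congr (A _ _); case: tpermP => [->|->|/eqP/negPf-> /eqP/negPf->//].
    by rewrite eqxx.
  by rewrite eqxx; case: eqP.
have Blo (a : 'I_k) b : (a < r)%N -> B a b = A a b.
  move=> ar; rewrite BE; case: eqP => [ea|_].
    by move: ri; rewrite -ea leqNgt ar.
  by case: eqP => // ea; move: ar; rewrite ea ltnn.
have Bze j : (forall i : 'I_k, (r <= i)%N -> A i j = 0) ->
    forall i : 'I_k, (r <= i)%N -> B i j = 0.
  move=> Aj a ra; rewrite BE Aj//; case: eqP => // _; by case: eqP.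
have Bcl (a : 'I_k) : (r < a)%N -> B a c = 0.
  move=> ra; rewrite BE; have nar : a != r by apply: contraTneq ra => ->; rewrite ltnn.
  rewrite (negPf nar); case: eqP => [ea|/eqP na]; last exact: one' (ltnW ra) na.
  by apply: one' => //; rewrite -ea eq_sym.
have [B0|B0] := lerP 0 (B r c); first by exists B; split.
pose B' : 'M[int]_(k, l) := \matrix_(a, b) (if a == r then - B a b else B a b).
exists B'; split.
- by apply: rst_trans AB _; apply/rst_step/RowNeg.
- move=> a b ar; rewrite mxE Blo//; case: eqP => // ea.
  by move: ar; rewrite ea ltnn.
- move=> j Aj a ra; rewrite mxE Bze//; case: ifP => _ //; exact: oppr0.
- move=> a ra; rewrite mxE Bcl// oppr0; by case: ifP.
- rewrite mxE eqxx; lia.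
Qed.

(** * Existence of the standard form *)

(** The first [c] columns of [A] are in standard form, and their nonzero rows are
the first [r] ones. *)
Definition standard_upto k l (A : 'M[int]_(k, l)) (r c : nat) : Prop :=
  [/\ forall (i : 'I_k) (j : 'I_l), (r <= i)%N -> (j < c)%N -> A i j = 0,
      forall i : 'I_k, (i < r)%N -> exists2 j : 'I_l, (j < c)%N & leading A i j,
      forall (i i' : 'I_k) (j' : 'I_l), (i < i')%N -> (j' < c)%N -> leading A i' j' ->
        exists2 j : 'I_l, (j < j')%N & leading A i j
    & forall (i : 'I_k) (j : 'I_l), (j < c)%N -> leading A i j ->
        0 < A i j /\ forall i' : 'I_k, (i' < i)%N -> 0 <= A i' j < A i j].

Lemma eq_leading k l (A B : 'M[int]_(k, l)) (c : nat) i (j : 'I_l) :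
  (forall i (j : 'I_l), (j < c)%N -> A i j = B i j) ->
  (j < c)%N -> leading A i j -> leading B i j.
Proof.
move=> AB jc [Aij A0]; split; first by rewrite -AB.
by move=> j' j'j; rewrite -AB ?A0//; apply: ltn_trans jc.
Qed.

Lemma eq_standard_upto k l (A B : 'M[int]_(k, l)) (r c : nat) :
  (forall i (j : 'I_l), (j < c)%N -> A i j = B i j) ->
  standard_upto A r c -> standard_upto B r c.
Proof.
move=> AB [z p e s].
have BA i (j : 'I_l) : (j < c)%N -> B i j = A i j by move=> ?; rewrite AB.
split.
- by move=> i j ri jc; rewrite BA// z.
- by move=> i /p[j jc Aj]; exists j => //; exact: eq_leading AB jc Aj.
- move=> i i' j' ii' j'c Bj'.
  have [j jj' Aj] := e _ _ _ ii' j'c (eq_leading BA j'c Bj').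
  by exists j => //; exact: eq_leading AB (ltn_trans jj' j'c) Aj.
- move=> i j jc Bj; have [pos above] := s _ _ jc (eq_leading BA jc Bj).
  by rewrite BA//; split=> // i' i'i; rewrite BA// above.
Qed.

Lemma leading_inj k l (A : 'M[int]_(k, l)) i j j' :
  leading A i j -> leading A i j' -> j = j'.
Proof.
move=> [n z] [n' z']; apply: val_inj => /=; case: (ltngtP j j') => // jj'.
  by rewrite z' ?eqxx in n.
by rewrite z ?eqxx in n'.
Qed.

Lemma standard_uptoS_nopivot k l (A : 'M[int]_(k, l)) (r : nat) (c : 'I_l) :
  standard_upto A r c -> (forall i : 'I_k, (r <= i)%N -> A i c = 0) ->
  standard_upto A r c.+1.
Proof.
move=> [z p e s] Ac.
have lc i (j : 'I_l) : (j < c.+1)%N -> leading A i j -> (j < c)%N.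
  rewrite ltnS leq_eqVlt => /predU1P[/val_inj->|//] [n0 z0].
  case: (ltnP i r) => [/p[j' j'c Aj']|/Ac E]; last by rewrite E eqxx in n0.
  by rewrite -{1}(leading_inj Aj' (conj n0 z0)).
split.
- move=> i j ri; rewrite ltnS leq_eqVlt => /predU1P[/val_inj->|]; [exact: Ac|exact: z].
- by move=> i /p[j jc Aj]; exists j => //; apply: ltnW.
- by move=> i i' j' ii' j'c Aj; apply: e ii' (lc _ _ j'c Aj) Aj.
- by move=> i j jc Aj; apply: s (lc _ _ jc Aj) Aj.
Qed.

Lemma standard_uptoS_pivot k l (A : 'M[int]_(k, l)) (r : 'I_k) (c : 'I_l) :
  standard_upto A r c -> (forall i : 'I_k, (r < i)%N -> A i c = 0) ->
  0 < A r c -> (forall i : 'I_k, (i < r)%N -> 0 <= A i c < A r c) ->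
  standard_upto A r.+1 c.+1.
Proof.
move=> [z p e s] below pos above.
have lr : leading A r c by split; [rewrite gt_eqF | move=> j jc; apply: z].
have lc i (j : 'I_l) : (j < c.+1)%N -> leading A i j -> (j < c)%N \/ i = r /\ j = c.
  rewrite ltnS leq_eqVlt => /predU1P[/val_inj->|jc]; last by left.
  case: (ltngtP i r) => [ir|ri|/val_inj->]; last by right.
    have [j' j'c Aj'] := p _ ir; move=> Ac.
    by move: j'c; rewrite (leading_inj Aj' Ac) ltnn.
  by move=> [n0 _]; rewrite below ?eqxx in n0.
split.
- move=> i j ri; rewrite ltnS leq_eqVlt => /predU1P[/val_inj->|jc]; first exact: below.
  by apply: z jc; apply: ltnW.
- move=> i; rewrite ltnS leq_eqVlt => /predU1P[/val_inj->|/p[j jc Aj]].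
    by exists c.
  by exists j => //; apply: ltnW.
- move=> i i' j' ii' j'c Aj'.
  case: (lc _ _ j'c Aj') => [j'c'|[ei ej]]; first exact: e ii' j'c' Aj'.
  by rewrite ej; apply: p; rewrite -ei.
- move=> i j jc Aj; case: (lc _ _ jc Aj) => [jc'|[-> ->]]; first exact: s jc' Aj.
  by split.
Qed.

Lemma exists_standard_upto k l (A : 'M[int]_(k, l)) (c : nat) : (c <= l)%N ->
  exists S : 'M[int]_(k, l), row_equivalent A S /\
    exists2 r : nat, (r <= k)%N & standard_upto S r c.
Proof.
elim: c => [_|c IHc ltcl].
  exists A; split; first exact: rst_refl.
  by exists 0%N => //; split.
have [S [AS [r lerk Ss]]] := IHc (ltnW ltcl).
pose c' := Ordinal ltcl.
move: lerk; rewrite leq_eqVlt => /predU1P[er|ltrk].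
  exists S; split=> //; exists r; first by rewrite er.
  apply: (@standard_uptoS_nopivot _ _ S r c') => // i; rewrite er => ki.
  by have := ltn_ord i; rewrite ltnNge ki.
pose r' := Ordinal ltrk.
have [B [SB lo ze cl po]] := row_equivalent_clear_column S r' c'.
have SBE i (j : 'I_l) : (j < c)%N -> S i j = B i j.
  move=> jc; case: (ltnP i r) => [/lo->//|ri].
  have [z _ _ _] := Ss; rewrite ze ?z// => i' ri'; exact: z.
have Bs := eq_standard_upto SBE Ss.
have AB : row_equivalent A B by apply: rst_trans SB.
have [B0|B0] := eqVneq (B r' c') 0.
  exists B; split=> //; exists r; first exact: ltnW.
  apply: (@standard_uptoS_nopivot _ _ B r c') => // i.
  by rewrite leq_eqVlt => /predU1P[ri|/cl//]; rewrite -(_ : r' = i)//; apply: val_inj.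
pose f (i : 'I_k) : int := if (i < r)%N then - (B i c' %/ B r' c')%Z else 0.
have fr0 : f r' = 0 by rewrite /f ltnn.
pose C : 'M[int]_(k, l) := \matrix_(i, j) (B i j + f i * B r' j).
have BC : row_equivalent B C by apply: row_equivalent_add_multiples.
have BCE i (j : 'I_l) : (j < c)%N -> B i j = C i j.
  by move=> jc; rewrite mxE; have [z _ _ _] := Bs; rewrite (z r')// mulr0 addr0.
have Bpos : 0 < B r' c' by rewrite lt_def B0.
have Crc : C r' c' = B r' c' by rewrite mxE fr0 mul0r addr0.
exists C; split; first exact: rst_trans BC.
exists r.+1 => //; apply: (@standard_uptoS_pivot _ _ C r' c').
- exact: eq_standard_upto BCE Bs.
- by move=> i ri; rewrite mxE cl// /f ltnNge ltnW// mul0r addr0.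
- by rewrite Crc.
- move=> i ir; rewrite Crc mxE /f ir mulNr.
  have := divz_eq (B i c') (B r' c'); have := modz_ge0 (B i c') B0.
  have := ltz_pmod (B i c') Bpos; lia.
Qed.

Lemma exists_standard_form k l (A : 'M[int]_(k, l)) :
  exists S, is_standard_form A S.
Proof.
have [S [AS [r _ [z p e s]]]] := exists_standard_upto A (leqnn l).
exists S; split=> //.
- by move=> i i' j' ii'; apply: e.
- by move=> i j /s[].
- by move=> i j /s[].
Qed.

Lemma standard_formP k l (A : 'M[int]_(k, l)) :
  is_standard_form A (standard_form A).
Proof. by apply: epsilon_spec; apply: exists_standard_form. Qed.

Lemma echelon_leading_ge k l (S : 'M[int]_(k, l)) i j :
  echelon S -> leading S i j -> (i <= j)%N.
Proof.
move=> eS; have [n] := ubnP (i : nat).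
elim: n i j => // n IHn [[|i] ik] j //; rewrite !ltnS /= => lein Sij.
have ik' : (i < k)%N := ltnW ik.
have [j' j'j Sj'] := eS (Ordinal ik') (Ordinal ik) j (leqnn _) Sij.
by apply: leq_trans j'j; apply: IHn Sj'.
Qed.

Lemma echelon_lower0 k l (S : 'M[int]_(k, l)) (i : 'I_k) (j : 'I_l) :
  echelon S -> (j < i)%N -> S i j = 0.
Proof.
move=> eS ji; apply/eqP/negPn/negP => Sij.
have exj : exists j : nat, [exists j' : 'I_l, (j' == j :> nat) && (S i j' != 0)].
  exists (j : nat); apply/existsP; exists j; by rewrite eqxx Sij.
case: (ex_minnP exj) => j0 /existsP[j' /andP[/eqP ej' Sij']] minj.
have lS : leading S i j'.
  split=> // j'' j''j'; apply/eqP/negPn/negP => Sij''.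
  have /minj : [exists j1 : 'I_l, (j1 == j'' :> nat) && (S i j1 != 0)].
    by apply/existsP; exists j''; rewrite eqxx Sij''.
  by rewrite -ej' leqNgt j''j'.
have := echelon_leading_ge eS lS.
have /minj : [exists j1 : 'I_l, (j1 == j :> nat) && (S i j1 != 0)].
  by apply/existsP; exists j; rewrite eqxx Sij.
lia.
Qed.

(** Invertible integer matrices are products of elementary ones: the only
invertible matrix in standard form is the identity. *)
Lemma row_equivalent_unit k (U : 'M[int]_k) :
  U \in unitmx -> row_equivalent U 1%:M.
Proof.
move=> Uu; have [S [US eS pos red]] := exists_standard_form U.
suff <- : S = 1%:M by [].
have [W [W' [SE UE]]] := row_equivalent_mull US.
have Su : S \in unitmx.
  have : (invmx U *m W') *m S = 1%:M by rewrite -mulmxA -UE mulVmx.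
  by case/mulmx1_unit.
have detS : \det S = \prod_i S i i.
  rewrite -det_tr det_trig; last first.
    by apply/is_trig_mxP => i j ij; rewrite mxE echelon_lower0.
  by apply: eq_bigr => i _; rewrite mxE.
have Si i : leading S i i /\ S i i = 1.
  have : S i i \is a GRing.unit.
    by move: Su; rewrite unitmxE detS (bigD1 i)//= unitrM => /andP[].
  have lS : S i i \is a GRing.unit -> leading S i i.
    move=> u; split; first by apply: contraTneq u => ->; rewrite unitr0.
    by move=> j ji; apply: echelon_lower0.
  move=> u; split; first exact: lS.
  by have := pos _ _ (lS u); move: u; rewrite /GRing.unit /=; lia.
apply/matrixP => i j; rewrite mxE; case: (ltngtP i j) => [ij|ji|/val_inj->].
- have [lS S1] := Si j; have := red _ _ lS _ ij; rewrite S1.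
  by rewrite (_ : (i == j) = false) /=; [lia|apply/negbTE; rewrite -val_eqE ltn_eqF].
- rewrite echelon_lower0// (_ : (i == j) = false)//.
  by apply/negbTE; rewrite -val_eqE gtn_eqF.
- by rewrite eqxx; have [] := Si j.
Qed.

Lemma row_equivalent_unit_mull k l (U : 'M[int]_k) (A : 'M[int]_(k, l)) :
  U \in unitmx -> row_equivalent (U *m A) A.
Proof. by move=> /row_equivalent_unit/(row_equivalent_mulr A); rewrite mul1mx. Qed.

(** The first two hypotheses say that [M] has the same row lattice as the block
matrix, the third one that the rows of [T] can be completed to a basis. *)
Lemma standard_form_block m n l (M : 'M[int]_(m + n, m + l))
    (B : 'M[int]_(m, l)) (T T' : 'M[int]_(n, l)) (X Z : 'M[int]_(m + n)) :
    M = X *m block_mx 1%:M B 0 T -> block_mx 1%:M B 0 T = Z *m M ->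
    T *m T'^T = 1%:M ->
  `|\det (ulsubmx (standard_form M))| = 1
  /\ row_equivalent (drsubmx (standard_form M)) T.
Proof.
set N := block_mx _ _ _ _ => MX NZ TT'.
have [MS eS _ _] := standard_formP M; set S := standard_form M in MS eS *.
have [W [W' [SW MW']]] := row_equivalent_mull MS.
pose U := W *m X; have SU : S = U *m N by rewrite SW MX mulmxA.
pose R := block_mx (1%:M : 'M[int]_m) (- (B *m T'^T)) 0 T'^T.
have NR : N *m R = 1%:M.
  rewrite mulmx_block !mul1mx !mul0mx !mulmx0 TT' addr0 !add0r addNr.
  by rewrite -scalar_mx_block.
have Uu : U \in unitmx.
  have : (Z *m W') *m U = 1%:M.
    rewrite -[LHS]mulmx1 -{1}NR mulmxA -[Z *m W' *m U *m N]mulmxA -SU.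
    by rewrite -[Z *m W' *m S]mulmxA -MW' -NZ.
  by case/mulmx1_unit.
have dl0 : dlsubmx U = 0.
  have -> : dlsubmx U = dlsubmx S.
    rewrite SU -{2}[U]submxK mulmx_block block_mxKdl.
    by rewrite mulmx1 mulmx0 addr0.
  by apply/matrixP=> i j; rewrite !mxE echelon_lower0//=; have := ltn_ord j; lia.
have SE : S = block_mx (ulsubmx U) (ulsubmx U *m B + ursubmx U *m T)
                       0 (drsubmx U *m T).
  by rewrite SU -{1}[U]submxK dl0 mulmx_block !mulmx1 !mulmx0 !mul0mx !addr0 add0r.
have : \det U \is a GRing.unit by rewrite -unitmxE.
rewrite -{1}[U]submxK dl0 det_ublock unitrM => /andP[ul dr]; split.
  by rewrite SE block_mxKul; move: ul; rewrite /GRing.unit /= => /orP[]/eqP->.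
by rewrite SE block_mxKdr; apply: row_equivalent_unit_mull; rewrite unitmxE.
Qed.

(** * Propagating labels along a braid *)

Lemma ord3_cases (s : 'I_3) : [\/ s = inord 0, s = inord 1 | s = inord 2].
Proof.
by case: s => -[|[|[|//]]] ?; [constructor 1|constructor 2|constructor 3];
  apply: val_inj; rewrite /= inordK.
Qed.

(** Position in which the overstrand of a letter enters the crossing; the understrand
leaves in this position. *)
Definition over_position (l : letter) : 'I_3 :=
  if l.2 then inord l.1.+1 else inord l.1.

(** Position in which the understrand enters and the overstrand leaves. *)
Definition under_position (l : letter) : 'I_3 :=
  if l.2 then inord l.1 else inord l.1.+1.

Lemma over_under_position l : over_position l != under_position l.
Proof.
case: l => -[i i2] []; rewrite /over_position /under_position /= -val_eqE /=;
  rewrite !inordK; lia.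
Qed.

Section Evolution.
Variables (X : Type) (init : 'I_3 -> X) (new : nat -> X -> X -> X).

(** Effect of the letter [l], occurring at time [t], on a labelling [g] of the
three positions: the overstrand keeps its label, while the outgoing part of the
understrand gets a label depending on [t] and on the incoming labels of the
overstrand and of the understrand. *)
Definition evolution_step (t : nat) (l : letter) (g : 'I_3 -> X) : 'I_3 -> X :=
  fun s => if s == under_position l then g (over_position l)
           else if s == over_position l
                then new t (g (over_position l)) (g (under_position l))
           else g s.

(** The labels of the three positions after the first [t] letters of [w]. *)
Fixpoint evolution (w : seq letter) (t : nat) : 'I_3 -> X :=
  if t is t'.+1 then
    evolution_step t' (nth (ord0, true) w t') (evolution w t')
  else init.

Lemma evolution_cat w1 w2 t s :
  (t <= size w1)%N -> evolution (w1 ++ w2) t s = evolution w1 t s.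
Proof.
elim: t s => //= t IHt s tw; rewrite /evolution_step nth_cat tw.
by rewrite !IHt // ltnW.
Qed.

Lemma evolution_rcons w l s :
  evolution (rcons w l) (size w).+1 s
  = evolution_step (size w) l (evolution w (size w)) s.
Proof.
rewrite /= nth_rcons ltnn eqxx /evolution_step -cats1.
by rewrite !evolution_cat.
Qed.

Definition piece_value (w : seq letter) (x : braid_piece w) : X :=
  evolution w x.1 x.2.

Section Pieces.
Variable w : seq letter.
Implicit Types (t : 'I_(size w)) (s : 'I_3).

Lemma braid_overE t : braid_over t =
  (before t (over_position (braid_letter t)),
   after t (under_position (braid_letter t))).
Proof.
by rewrite /braid_over /rising /falling /upper /lower /over_position
  /under_position; case: ifP.
Qed.

Lemma braid_underE t : braid_under t =
  (before t (under_position (braid_letter t)),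
   after t (over_position (braid_letter t))).
Proof.
by rewrite /braid_under /rising /falling /upper /lower /over_position
  /under_position; case: ifP.
Qed.

Lemma piece_value_after t s : piece_value (after t s) =
  evolution_step t (braid_letter t) (fun s' => piece_value (before t s')) s.
Proof.
rewrite /piece_value /after /before /= /bump /= /evolution_step.
by rewrite /braid_letter (tnth_nth (ord0, true)).
Qed.

Lemma piece_value_over t :
  piece_value (braid_over t).2 = piece_value (braid_over t).1.
Proof. by rewrite braid_overE piece_value_after /evolution_step eqxx. Qed.

Lemma piece_value_under t : piece_value (braid_under t).2 =
  new t (piece_value (braid_over t).1) (piece_value (braid_under t).1).
Proof.
rewrite braid_overE braid_underE piece_value_after /evolution_step eqxx.
by rewrite (negPf (over_under_position _)).
Qed.

Lemma not_upper_lower t s : (s != upper t) && (s != lower t) =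
  (s != over_position (braid_letter t)) && (s != under_position (braid_letter t)).
Proof.
rewrite /upper /lower /over_position /under_position.
by case: ifP => //; rewrite andbC.
Qed.

Hypothesis cap : init (inord 1) = init (inord 2).

Lemma piece_value_adjacent (x y : braid_piece w) :
  adjacent (D := closed_braid w) x y -> piece_value x = piece_value y.
Proof.
have joinedP (x' y' : braid_piece w) :
    braid_joined x' y' -> piece_value x' = piece_value y'.
  case/orP=> [/existsP[t /existsP[s]]|/andP[/eqP-> /eqP->]]; last exact: cap.
  rewrite andbA not_upper_lower => /andP[/andP[so su] /andP[/eqP-> /eqP->]].
  by rewrite piece_value_after /evolution_step (negPf so) (negPf su).
case/or3P=> [/joinedP//|/joinedP//|/existsP[t] /=].
by have := piece_value_over t; case: (braid_over t) => a b /= ba /orP[]/eqP[<- <-].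
Qed.

Lemma piece_value_arc (x y : piece (closed_braid w)) :
  arc_of x = arc_of y -> @piece_value w x = @piece_value w y.
Proof.
move=> xy; have : y \in arc_of (D := closed_braid w) x by rewrite xy inE connect0.
rewrite inE => /connectP[p + ->]; elim: p x {xy} => //= z p IHp x.
by move=> /andP[/piece_value_adjacent-> /IHp].
Qed.

End Pieces.
End Evolution.

Section Arcs.
Variables (n : nat) (D : tangle_diagram n).

Lemma adjacent_sym : symmetric (@adjacent n D).
Proof.
move=> x y; rewrite /adjacent orbCA; congr [|| _, _ | _].
by apply: eq_existsb => c; rewrite orbC.
Qed.

Lemma connect_arc_of (x y : piece D) :
  connect (@adjacent n D) x y -> arc_of x = arc_of y.
Proof.
move=> xy; apply/setP=> z; rewrite !inE.
exact: (same_connect (sym_connect_sym adjacent_sym) xy).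
Qed.

End Arcs.

(** * The arcs of a closed braid *)

Section Labels.
Variable w : seq letter.
Let D := closed_braid w.

(** Labels distinguishing the arcs: the upper left piece and the cap start with the
labels 0 and 1, and the crossing at time [t] introduces the label [t + 2]. *)
Definition label : nat -> 'I_3 -> nat :=
  evolution (fun s : 'I_3 => val s != 0%N : nat) (fun t _ _ => t.+2) w.

Definition piece_label (x : braid_piece w) : nat := label x.1 x.2.

(** A leftmost piece with a given label, namely the outgoing part of the understrand
of a crossing for the labels from 2 on. *)
Definition label_piece (k : nat) : braid_piece w :=
  if k is t.+2 then (inord t.+1, over_position (nth (ord0, true) w t))
  else (ord0, inord k).

Lemma label_cap : (val (inord 1 : 'I_3) != 0%N : nat) = (val (inord 2 : 'I_3) != 0%N).
Proof. by rewrite /= !inordK. Qed.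

Lemma piece_label_arc (x y : piece D) : arc_of x = arc_of y -> piece_label x = piece_label y.
Proof. exact: piece_value_arc label_cap _ _. Qed.

Lemma label_lt t s : (label t s < t.+2)%N.
Proof.
elim: t s => [|t IHt] s; first by rewrite /label /=; case: eqP.
rewrite /label /= /evolution_step.
by case: ifP => _; [|case: ifP => _]; rewrite ?ltnS ?leqnn // ltnW // IHt.
Qed.

Lemma piece_label_lt (x : braid_piece w) : (piece_label x < (size w).+2)%N.
Proof. by apply: leq_trans (label_lt _ _) _; rewrite ltnS; case: x => -[]. Qed.

Lemma label_pieceK k : (k < (size w).+2)%N -> piece_label (label_piece k) = k.
Proof.
case: k => [|[|t]] kw; rewrite /piece_label /label /= ?inordK //=.
by rewrite /evolution_step eqxx (negPf (over_under_position _)).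
Qed.

Lemma adjacent_over (t : 'I_(size w)) :
  adjacent (D := D) (braid_over t).1 (braid_over t).2.
Proof.
apply/or3P/Or33/existsP; exists t; rewrite /=.
by case: (braid_over t) => a b; rewrite eqxx.
Qed.

Lemma adjacent_straight (t : 'I_(size w)) (s : 'I_3) :
  s != over_position (braid_letter t) -> s != under_position (braid_letter t) ->
  adjacent (D := D) (before t s) (after t s).
Proof.
move=> so su; apply/or3P/Or31/orP; left; apply/existsP; exists t.
by apply/existsP; exists s; rewrite andbA not_upper_lower so su !eqxx.
Qed.

Lemma adjacent_cap : adjacent (D := D) (ord0, inord 1) (ord0, inord 2).
Proof. by apply/or3P/Or31/orP; right; rewrite !eqxx. Qed.

(** Induction on the pieces of a closed braid, from left to right. *)
Lemma piece_ind (P : braid_piece w -> Prop) :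
  (forall s, P (ord0, s)) ->
  (forall t, (forall s, P (before t s)) -> forall s, P (after t s)) ->
  forall x, P x.
Proof.
move=> P0 PS [[t tw] s]; elim: t tw s => [|t IHt] tw s.
  by rewrite (_ : Ordinal tw = ord0) //; apply: val_inj.
pose t' : 'I_(size w) := Ordinal (tw : (t < size w)%N).
rewrite (_ : Ordinal tw = lift ord0 t'); last exact: val_inj.
apply: (PS t') => s'; rewrite /before.
rewrite (_ : widen_ord _ _ = Ordinal (ltnW tw)); last exact: val_inj.
exact: IHt.
Qed.

Lemma connect_label_piece (x : braid_piece w) :
  connect (@adjacent 2 D) (label_piece (piece_label x)) x.
Proof.
elim/piece_ind: x => [s|t IHt s].
  case: (ord3_cases s) => [->|->|->].
  - by rewrite /piece_label /label /= inordK.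
  - by rewrite /piece_label /label /= inordK.
  - by rewrite /piece_label /label /= inordK //; apply/connect1/adjacent_cap.
have lE := piece_value_after (fun s : 'I_3 => val s != 0%N : nat) (fun t _ _ => t.+2) t s.
rewrite [piece_label _]lE /evolution_step.
case: ifP => [/eqP->|su].
  apply: connect_trans (IHt _) _; apply: connect1.
  by have := adjacent_over t; rewrite braid_overE.
case: ifP => [/eqP->|so].
  rewrite /label_piece /after /braid_letter (tnth_nth (ord0, true)) /=.
  rewrite (_ : inord t.+1 = lift ord0 t) ?connect0 //.
  by apply: val_inj; rewrite /= inordK // ltnS.
apply: connect_trans (IHt _) _; apply: connect1.
by apply: adjacent_straight; rewrite ?so ?su.
Qed.

Lemma arc_label_piece (x : piece D) :
  arc_of (D := D) (label_piece (piece_label x)) = arc_of x.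
Proof. exact/connect_arc_of/connect_label_piece. Qed.

Lemma card_arcs : #|[set arc_of x | x : piece D]| = (size w).+2.
Proof.
pose A (k : 'I_(size w).+2) := arc_of (D := D) (label_piece k).
have injA : injective A.
  by move=> k k' /piece_label_arc; rewrite !label_pieceK //; apply: val_inj.
rewrite (_ : [set _ | _ in _] = [set A k | k : 'I_(size w).+2]).
  by rewrite card_imset // card_ord.
apply/setP=> a; apply/imsetP/imsetP=> [[x _ ->]|[k _ ->]]; last by exists (label_piece k).
by exists (Ordinal (piece_label_lt x)); rewrite // /A arc_label_piece.
Qed.

(** The upper left piece has label 0.  The statement thus says that, among this piece
and the three pieces at time [t], no three are on the same arc. *)
Lemma label_spread t :
  (forall s s', s != s' -> label t s = 0%N -> label t s' <> 0%N) /\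
  exists s s', label t s != label t s'.
Proof.
elim: t => [|t [zero _]].
  split=> [s s' nss'|]; last by exists ord0, (inord 1); rewrite /label /= inordK.
  by rewrite /label /=; move: nss'; rewrite -val_eqE /=; case: s s' => [[|s] ?] [[|s'] ?].
set l := nth (ord0, true) w t; have ou := over_under_position l.
have E s : label t.+1 s = evolution_step (fun t _ _ => t.+2) t l (label t) s by [].
split=> [s s' nss'|].
  rewrite !E /evolution_step.
  have [es|su] := eqVneq s (under_position l); have [es'|su'] := eqVneq s' (under_position l).
  - by rewrite es es' eqxx in nss'.
  - by case: eqP => // /eqP so'; apply: zero; rewrite eq_sym.
  - by case: eqP => // /eqP so; apply: zero.
  - by case: eqP => // /eqP so; case: eqP => // /eqP so'; apply: zero.
exists (under_position l), (over_position l).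
rewrite !E /evolution_step !eqxx (negPf ou).
by rewrite neq_ltn label_lt.
Qed.

Lemma endpoint_arc_distinct (e1 e2 e3 : 'I_(2.*2)) : (e1 < e2 < e3)%N ->
  endpoint_arc D e1 = endpoint_arc D e2 -> endpoint_arc D e2 <> endpoint_arc D e3.
Proof.
move=> /andP[e12 e23] /piece_label_arc l12 /piece_label_arc l23.
have [zero [s [s']]] := label_spread (size w).
have E (e : 'I_(2.*2)) : (0 < e)%N -> piece_label (braid_endpoint w e) = label (size w) (inord e.-1).
  by case: e => -[|e] ?.
have e2_gt0 : (0 < e2)%N by apply: leq_trans e12.
move: l12 l23; rewrite /= (E e2) // (E e3) ?(ltn_trans e2_gt0) //.
have [e10|e1_gt0] := posnP e1.
  have -> : e1 = ord0 by apply: val_inj.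
  rewrite [X in X = _ -> _]/piece_label [X in X = _ -> _]/label /= => /esym l2 l3 _.
  have ne : inord e2.-1 != inord e3.-1 :> 'I_3.
    by rewrite -val_eqE /= !inordK; have := ltn_ord e3; lia.
  by case: (zero _ _ ne l2); rewrite -l3.
rewrite (E e1) //; have [-> -> ->] : [/\ e1 = 1 :> nat, e2 = 2 :> nat & e3 = 3 :> nat]%N.
  by have := ltn_ord e3; split; lia.
rewrite /= => l1 l2.
suff L s0 : label (size w) s0 = label (size w) (inord 1) by rewrite !L eqxx.
by case: (ord3_cases s0) => ->.
Qed.

End Labels.

(** If no three values of [f] coincide, each coincidence reduces the number of values
by one. *)
Lemma card_equal_pairs (T : finType) (f : 'I_(2.*2) -> T) :
  (forall e1 e2 e3 : 'I_(2.*2), (e1 < e2 < e3)%N -> f e1 = f e2 -> f e2 <> f e3) ->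
  (#|{: {e : 'I_(2.*2) * 'I_(2.*2) | (e.1 < e.2)%N && (f e.1 == f e.2)}}|
   + #|[set f e | e : 'I_(2.*2)]| = 4)%N.
Proof.
move=> f3; rewrite card_sig.
have -> : #|[pred e : 'I_(2.*2) * 'I_(2.*2) | (e.1 < e.2)%N && (f e.1 == f e.2)]|
    = (\sum_(i : 'I_(2.*2)) \sum_(j : 'I_(2.*2)) ((i < j)%N && (f i == f j)))%N.
  by rewrite pair_bigA -sum1_card big_mkcond; apply: eq_bigr => e _; rewrite inE; case: ifP.
rewrite !big_ord_recl !big_ord0 /=.
set b : 'I_4 := lift ord0 ord0; set c : 'I_4 := lift ord0 (lift ord0 ord0).
set d : 'I_4 := lift ord0 (lift ord0 (lift ord0 ord0)); set a : 'I_4 := ord0.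
have -> : [set f e | e : 'I_(2.*2)] = f a |: (f b |: (f c |: [set f d])).
  apply/setP=> x; rewrite !inE; apply/imsetP/or4P.
    case=> -[[|[|[|[|//]]]] ?] _ ->; [constructor 1|constructor 2|constructor 3|constructor 4];
    by apply/eqP; congr f; apply: val_inj.
  by case=> /eqP->; [exists a|exists b|exists c|exists d].
rewrite !cardsU1 cards1 !inE.
have abc := f3 a b c isT; have abd := f3 a b d isT; have acd := f3 a c d isT.
have bcd := f3 b c d isT.
move: abc abd acd bcd.
do 6!case: eqP => //=; intuition congruence.
Qed.

(** * Colors of a rational tangle *)

(** The coloring of the positions in which the upper left piece has color 0 and the
cap has color 1; the relation at a crossing determines the new color. *)
Definition color : seq letter -> nat -> 'I_3 -> int :=
  evolution (fun s : 'I_3 => if val s is 0%N then 0 else 1) (fun _ x y => 2 * x - y).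

Definition piece_color (w : seq letter) (x : braid_piece w) : int := color w x.1 x.2.

(** The colors at the right end of the braid. *)
Definition final_color (w : seq letter) : 'I_3 -> int := color w (size w).

Lemma final_color_nseq w (i : 'I_2) b n s :
  let d := final_color w (inord i.+1) - final_color w (inord i) in
  final_color (w ++ nseq n (i, b)) s = final_color w s +
    (if (s == inord i) || (s == inord i.+1) then (-1) ^+ (~~ b) * n%:Z * d else 0).
Proof.
move=> d; elim: n s => [|n IHn] s.
  by rewrite cats0 mulr0 mul0r if_same addr0.
have -> : w ++ nseq n.+1 (i, b) = rcons (w ++ nseq n (i, b)) (i, b).
  by rewrite -(addn1 n) nseqD catA cats1.
rewrite /final_color size_rcons [LHS]evolution_rcons /evolution_step.
rewrite -!/(final_color _) -![evolution _ _ (w ++ _) _ _]/(final_color (w ++ _) _).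
rewrite !IHn; have := over_under_position (i, b).
rewrite /over_position /under_position /=.
have nii : inord i.+1 != inord i :> 'I_3.
  by rewrite -val_eqE /= !inordK; have := ltn_ord i; lia.
have nii' : (inord i == inord i.+1 :> 'I_3) = false by rewrite eq_sym (negPf nii).
case: b {IHn} => _; rewrite /= ?expr0 ?expr1 ?eqxx ?orbT /=.
  case: eqP => [->|_] /=; first by rewrite /d; ring.
  by case: eqP => [->|_] /=; rewrite ?addr0 // /d; ring.
case: (s =P inord i.+1) => [->|_] /=; first by rewrite orbT /d; ring.
rewrite orbF; by case: eqP => [->|_] /=; rewrite ?addr0 // /d; ring.
Qed.

Lemma final_color_power w (i : 'I_2) z s :
  let d := final_color w (inord i.+1) - final_color w (inord i) in
  final_color (w ++ braid_power i z) s = final_color w s +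
    (if (s == inord i) || (s == inord i.+1) then z * d else 0).
Proof.
rewrite /= final_color_nseq; congr (_ + _); case: ifP => // _; congr (_ * _).
by case: (lerP 0 z) => z0 /=; rewrite ?expr0 ?expr1; lia.
Qed.

Lemma rational_word_rcons cs c : rational_word (rcons cs c) =
  rational_word cs ++
  (if odd (size cs) then braid_power 1 c else braid_power 0 (- c)).
Proof.
rewrite /rational_word size_rcons -(addn1 (size cs)) iotaD map_cat flatten_cat /= cats0 add0n.
rewrite nth_rcons ltnn eqxx; congr (flatten _ ++ _).
by apply/eq_in_map => j; rewrite mem_iota add0n => /andP[_ jlt]; rewrite nth_rcons jlt.
Qed.

(** The recursion [E(c_1, ..., c_h) = E(c_1, ..., c_(h-2)) + c_h E(c_1, ..., c_(h-1))]
of the Euler brackets at their right end, on pairs of consecutive values. *)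
Definition convergent_step (x : int * int) (c : int) : int * int := (x.2, x.1 + c * x.2).

(** The definition of Euler brackets expands them at their left end, so this is proved
for an arbitrary starting pair. *)
Lemma foldl_convergent_step x y cs :
  (foldl convergent_step (x, y) cs).2
  = y * euler_bracket cs + x * (if cs is _ :: cs' then euler_bracket cs' else 0).
Proof.
have E0 : euler_bracket [::] = 1 by rewrite /euler_bracket /= big_seq1 big_nil.
have EC a cs' : euler_bracket (a :: cs') = a * euler_bracket cs'
    + (if cs' is _ :: cs2 then euler_bracket cs2 else 0).
  rewrite /euler_bracket /= big_cat big_map /=; congr (_ + _).
    by rewrite mulr_sumr; apply: eq_bigr => s _; rewrite big_cons.
  by case: cs' => // ; rewrite big_nil.
elim: cs x y => [|a cs IHcs] x y; first by rewrite E0 /= mulr1 mulr0 addr0.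
by rewrite /= IHcs EC; ring.
Qed.

(** The pair of [E(c_1, ..., c_(h-1))] and [E(c_1, ..., c_h)]; the first component is 0
for the empty sequence. *)
Definition convergents (cs : seq int) : int * int := foldl convergent_step (0, 1) cs.

Lemma convergents_rcons cs c :
  convergents (rcons cs c) = convergent_step (convergents cs) c.
Proof. by rewrite /convergents foldl_rcons. Qed.

Lemma convergents2 cs : (convergents cs).2 = euler_bracket cs.
Proof. by rewrite foldl_convergent_step mul1r mul0r addr0. Qed.

Lemma convergents1 cs : cs != [::] ->
  (convergents cs).1 = euler_bracket (take (size cs).-1 cs).
Proof.
case/lastP: cs => // cs c _.
by rewrite convergents_rcons /= convergents2 size_rcons -cats1 take_size_cat.
Qed.

Lemma convergents_bezout cs :
  exists a b : int, a * (convergents cs).2 + b * (convergents cs).1 = 1.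
Proof.
elim/last_ind: cs => [|cs c [a [b ab]]]; first by exists 1, 0.
by rewrite convergents_rcons /=; exists b, (a - b * c); rewrite -ab; ring.
Qed.

(** The final colors in terms of the differences [d1] and [d2] of consecutive ones:
the alternating sum of the three colors is preserved by every letter, and is 0. *)
Lemma final_color_rational cs :
  let: (x, y) := convergents cs in
  let: (d1, d2) := if odd (size cs) then (x, y) else (y, x) in
  [/\ final_color (rational_word cs) (inord 0) = - d2,
      final_color (rational_word cs) (inord 1) = d1 - d2
    & final_color (rational_word cs) (inord 2) = d1].
Proof.
elim/last_ind: cs => [|cs c]; first by split; rewrite /final_color /color /= inordK.
rewrite convergents_rcons size_rcons rational_word_rcons /=.
case: (convergents cs) => x y /=; case: (odd (size cs)) => /= -[e0 e1 e2];
  rewrite !final_color_power /= e0 e1 e2 -!val_eqE /= !inordK //=; split; ring.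
Qed.

(** * Existence of a coloring matrix *)

(** The arc of each column of a coloring matrix, given the arcs of its first columns. *)
Definition column_arc n (D : tangle_diagram n) m (inner : 'I_m -> {set piece D})
    (j : 'I_(m + n.*2)) : {set piece D} :=
  match split j with inl j' => inner j' | inr e => endpoint_arc D e end.

Section Columns.
Variables (n : nat) (D : tangle_diagram n) (m : nat) (inner : 'I_m -> {set piece D}).
Hypothesis inner_interior : [set inner j | j : 'I_m] = interior_arcs D.

Lemma column_arc_lshift j : column_arc inner (lshift (n.*2) j) = inner j.
Proof. by rewrite /column_arc -[lshift _ j]/(unsplit (inl j)) unsplitK. Qed.

Lemma column_arc_rshift e : column_arc inner (rshift m e) = endpoint_arc D e.
Proof. by rewrite /column_arc -[rshift m e]/(unsplit (inr e)) unsplitK. Qed.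

Lemma column_arc_surj (x : piece D) : exists j, column_arc inner j = arc_of x.
Proof.
have [/imsetP[e _ ->]|xNend] := boolP (arc_of x \in [set endpoint_arc D e | e : 'I_(n.*2)]).
  by exists (rshift m e); rewrite column_arc_rshift.
have : arc_of x \in interior_arcs D by rewrite inE xNend; apply: imset_f.
rewrite -inner_interior => /imsetP[j _ ->].
by exists (lshift _ j); rewrite column_arc_lshift.
Qed.

Lemma column_arc_piece j : exists x, column_arc inner j = arc_of x.
Proof.
rewrite -[j]splitK; case: (split j) => [j'|e] /=.
  have : inner j' \in interior_arcs D by rewrite -inner_interior; apply: imset_f.
  by rewrite inE column_arc_lshift => /andP[_ /imsetP[x _ ->]]; exists x.
by exists (endpoint D e); rewrite column_arc_rshift.
Qed.

End Columns.

Lemma card_equation w :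
  #|equation (closed_braid w)| = (#|interior_arcs (closed_braid w)| + 2)%N.
Proof.
set D := closed_braid w; set E := [set endpoint_arc D e | e : 'I_(2.*2)].
have EA : E \subset [set arc_of x | x : piece D].
  by apply/subsetP=> _ /imsetP[e _ ->]; apply: imset_f.
have := cardsD [set arc_of x | x : piece D] E; rewrite (setIidPr EA).
have := subset_leq_card EA; rewrite card_arcs -/(interior_arcs D).
have := card_equal_pairs (@endpoint_arc_distinct w).
rewrite /equation card_sum card_ord -/E => /=.
have arith (a b c d : nat) :
    (b + c = 4 -> c <= a.+2 -> d = a.+2 - c -> a + b = d + 2)%N by lia.
exact: arith.
Qed.

Lemma exists_coloring_matrix w :
  exists m (M : 'M[int]_(m + 2, m + 2.*2)), is_coloring_matrix (closed_braid w) M.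
Proof.
set D := closed_braid w; set m := #|interior_arcs D|.
pose inner (j : 'I_m) : {set piece D} := enum_val j.
have inner_interior : [set inner j | j : 'I_m] = interior_arcs D.
  apply/setP=> a; apply/imsetP/idP => [[j _ ->]|aI]; first exact: enum_valP.
  by exists (enum_rank_in aI a) => //; rewrite /inner enum_rankK_in.
pose eq (r : 'I_(m + 2)) : equation D := enum_val (cast_ord (esym (card_equation w)) r).
have eq_bij : bijective eq.
  exists (fun c => cast_ord (card_equation w) (enum_rank c)) => [r|c].
    by rewrite /eq enum_valK cast_ordKV.
  by rewrite /eq cast_ordK enum_rankK.
have exrow r : exists v : 'rV[int]_(m + 2.*2), forall M : 'M[int]_(m + 2, m + 2.*2),
    row r M = v -> is_equation_row (column_arc inner) M r (eq r).
  case: (eq r) => [c|s] /=; last by eexists=> M; apply.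
  have [x ex] := column_arc_surj inner_interior (Defs.over c).1.
  have [y ey] := column_arc_surj inner_interior (under c).1.
  have [z ez] := column_arc_surj inner_interior (under c).2.
  by eexists => M; exists x, y, z; split; eauto.
have [v vP] := fin_all_exists exrow.
exists m, (\matrix_r v r), eq, inner; split=> //; first exact: enum_val_inj.
by move=> r; apply: vP; rewrite rowK.
Qed.

(** * The row lattice of a coloring matrix *)

(** [v] is an integral combination of the rows of [M]. *)
Definition in_row_lattice k l (M : 'M[int]_(k, l)) (v : 'rV[int]_l) : Prop :=
  exists u, v = u *m M.

Section RowLattice.
Variables (k l : nat) (M : 'M[int]_(k, l)).
Notation L := (in_row_lattice M).

Lemma row_lattice0 : L 0. Proof. by exists 0; rewrite mul0mx. Qed.

Lemma row_latticeD v w : L v -> L w -> L (v + w).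
Proof. by move=> [a ->] [b ->]; exists (a + b); rewrite mulmxDl. Qed.

Lemma row_latticeZ c v : L v -> L (c *: v).
Proof. by move=> [a ->]; exists (c *: a); rewrite scalemxAl. Qed.

Lemma row_latticeN v : L v -> L (- v).
Proof. by rewrite -scaleN1r; apply: row_latticeZ. Qed.

Lemma row_lattice_row r : L (row r M).
Proof. by exists (delta_mx 0 r); rewrite rowE. Qed.

Lemma row_lattice_mull h (A : 'M[int]_(h, l)) :
  (forall i, L (row i A)) -> exists X, A = X *m M.
Proof.
move=> /fin_all_exists[u uP]; exists (\matrix_i u i).
by apply/row_matrixP=> i; rewrite uP row_mul rowK.
Qed.

End RowLattice.

Section ColoringLattice.
Variables (n : nat) (D : tangle_diagram n) (m : nat) (inner : 'I_m -> {set piece D}).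
Variables (M : 'M[int]_(m + n, m + n.*2)) (eq : 'I_(m + n) -> equation D).
Hypotheses (eq_bij : bijective eq) (inner_inj : injective inner).
Hypothesis inner_interior : [set inner j | j : 'I_m] = interior_arcs D.
Hypothesis rows : forall r, is_equation_row (column_arc inner) M r (eq r).

Local Notation e_ j := (delta_mx (0 : 'I_1) j : 'rV[int]_(m + n.*2)).
Local Notation L := (in_row_lattice M).

(** Distinct columns with the same arc belong to the two endpoints of a string that
projects to a single arc, whose equation is a row. *)
Lemma row_lattice_same_arc i j :
  column_arc inner i = column_arc inner j -> L (e_ i - e_ j).
Proof.
have [f eqK feK] := eq_bij.
have lt_pair (e e' : 'I_(n.*2)) : (e < e')%N ->
    endpoint_arc D e = endpoint_arc D e' -> L (e_ (rshift m e) - e_ (rshift m e')).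
  move=> ee' aee'.
  have ok : ((e, e').1 < (e, e').2)%N && (endpoint_arc D (e, e').1 == endpoint_arc D (e, e').2).
    by rewrite ee' aee' eqxx.
  have := rows (f (inr (exist _ (e, e') ok))); rewrite feK /= => <-.
  exact: row_lattice_row.
have inner_end j' e : inner j' <> endpoint_arc D e.
  move=> E; have : inner j' \in interior_arcs D by rewrite -inner_interior; apply: imset_f.
  by rewrite inE E => /andP[/negP[]]; apply: imset_f.
rewrite -[i]splitK -[j]splitK.
case: (split i) => [i'|e]; case: (split j) => [j'|e'] /=;
  rewrite ?column_arc_lshift ?column_arc_rshift.
- by move/inner_inj->; rewrite subrr; apply: row_lattice0.
- by move/inner_end.
- by move/esym/inner_end.
- case: (ltngtP e e') => [ee'|e'e|/val_inj->] E; first exact: lt_pair.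
    by rewrite -opprB; apply: row_latticeN; apply: lt_pair.
  by rewrite subrr; apply: row_lattice0.
Qed.

Lemma row_lattice_crossing (c : crossing D) x y z :
  column_arc inner x = arc_of (Defs.over c).1 ->
  column_arc inner y = arc_of (under c).1 ->
  column_arc inner z = arc_of (under c).2 ->
  L (e_ y + e_ z - 2 *: e_ x).
Proof.
move=> ex ey ez; have [f eqK feK] := eq_bij.
have := rows (f (inl c)); rewrite feK /= => -[x' [y' [z' [ex' ey' ez' rE]]]].
have -> : e_ y + e_ z - 2 *: e_ x = row (f (inl c)) M
    + (e_ y - e_ y') + (e_ z - e_ z') - 2 *: (e_ x - e_ x').
  by rewrite rE; apply/matrixP=> a b; rewrite !mxE; ring.
apply: row_latticeD; last first.
  by apply/row_latticeN/row_latticeZ/row_lattice_same_arc; rewrite ex ex'.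
apply: row_latticeD; last by apply: row_lattice_same_arc; rewrite ez ez'.
apply: row_latticeD; last by apply: row_lattice_same_arc; rewrite ey ey'.
exact: row_lattice_row.
Qed.

(** An integer coloring of the arcs is orthogonal to the row lattice. *)
Lemma row_lattice_sum (y : 'I_(m + n.*2) -> int) v :
  (forall i j, column_arc inner i = column_arc inner j -> y i = y j) ->
  (forall (c : crossing D) i j k,
    column_arc inner i = arc_of (Defs.over c).1 ->
    column_arc inner j = arc_of (under c).1 ->
    column_arc inner k = arc_of (under c).2 -> y j + y k = 2 * y i) ->
  L v -> \sum_j v 0 j * y j = 0.
Proof.
move=> ysame ycross [u ->].
pose Y : 'cV[int]_(m + n.*2) := \col_j y j.
have eY j : (e_ j *m Y) 0 0 = y j by rewrite -rowE !mxE.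
have MY : M *m Y = 0.
  apply/row_matrixP=> r; rewrite row_mul row0; apply/rowP=> i; rewrite ord1 [RHS]mxE.
  have := rows r; case: (eq r) => [c|s] /=.
    move=> [x [y' [z [ex ey ez ->]]]].
    rewrite mulmxBl mulmxDl -scalemxAl.
    have -> (A B C : 'M[int]_1) : (A + B - 2 *: C) 0 0 = A 0 0 + B 0 0 - 2 * C 0 0.
      by rewrite !mxE.
    by rewrite !eY (ycross c x) // subrr.
  move=> ->; rewrite mulmxBl.
  have -> (A B : 'M[int]_1) : (A - B) 0 0 = A 0 0 - B 0 0 by rewrite !mxE.
  rewrite !eY (ysame _ (rshift m (val s).2)) ?subrr // !column_arc_rshift.
  by case: s => /= x /andP[_ /eqP].
have : (u *m M *m Y) 0 0 = 0 by rewrite -mulmxA MY mulmx0 mxE.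
by rewrite mxE => {2}<-; apply: eq_bigr => j _; rewrite mxE [Y j 0]mxE.
Qed.

End ColoringLattice.

Lemma color_cap : (if val (inord 1 : 'I_3) is 0%N then 0 else 1) =
                  (if val (inord 2 : 'I_3) is 0%N then 0 else 1) :> int.
Proof. by rewrite /= !inordK. Qed.

Lemma piece_color_arc w (x y : piece (closed_braid w)) :
  arc_of x = arc_of y -> @piece_color w x = @piece_color w y.
Proof. exact: piece_value_arc color_cap _ _. Qed.

Section BraidLattice.
Variables (w : seq letter) (m : nat).
Let D := closed_braid w.
Variables (inner : 'I_m -> {set piece D}) (M : 'M[int]_(m + 2, m + 2.*2)).
Variable eq : 'I_(m + 2) -> equation D.
Hypotheses (eq_bij : bijective eq) (inner_inj : injective inner).
Hypothesis inner_interior : [set inner j | j : 'I_m] = interior_arcs D.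
Hypothesis rows : forall r, is_equation_row (column_arc inner) M r (eq r).

Local Notation e_ j := (delta_mx (0 : 'I_1) j : 'rV[int]_(m + 2.*2)).
Local Notation L := (in_row_lattice M).

(** Every column is determined, modulo the row lattice, by the columns [j0] and [j1]
of the upper left piece and of the cap. *)
Lemma row_lattice_color j0 j1 (x : piece D) j :
  column_arc inner j0 = arc_of (D := D) (ord0, inord 0) ->
  column_arc inner j1 = arc_of (D := D) (ord0, inord 1) ->
  column_arc inner j = arc_of x ->
  L (e_ j - (1 - @piece_color w x) *: e_ j0 - @piece_color w x *: e_ j1).
Proof.
move=> E0 E1.
have same := row_lattice_same_arc eq_bij inner_inj inner_interior rows.
pose P (y : braid_piece w) := forall i, column_arc inner i = arc_of (D := D) y ->
  L (e_ i - (1 - piece_color y) *: e_ j0 - piece_color y *: e_ j1).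
have Parc (y z : braid_piece w) : arc_of (D := D) y = arc_of (D := D) z -> P y -> P z.
  by move=> yz Py i; rewrite -yz -(piece_color_arc yz); apply: Py.
suff : P x by apply.
elim/piece_ind: x {j} => [s|t IHt s].
  have P1 : P (ord0, inord 1).
    move=> i iE; rewrite /piece_color /color /= inordK //= subrr scale0r subr0 scale1r.
    by apply: same; rewrite iE E1.
  case: (ord3_cases s) => [->|->|->].
  - move=> i iE; rewrite /piece_color /color /= inordK //= subr0 scale0r subr0 scale1r.
    by apply: same; rewrite iE E0.
  - exact: P1.
  - by apply: Parc P1; apply/connect_arc_of/connect1/adjacent_cap.
have [->|su] := eqVneq s (under_position (braid_letter t)).
  apply: Parc (IHt (over_position (braid_letter t))).
  by have := connect_arc_of (D := D) (connect1 (adjacent_over t)); rewrite braid_overE.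
have [->|so] := eqVneq s (over_position (braid_letter t)); last first.
  by apply: Parc (IHt s); apply/connect_arc_of/connect1/adjacent_straight.
have Po : P (braid_over t).1 by rewrite braid_overE; apply: IHt.
have Pu : P (braid_under t).1 by rewrite braid_underE; apply: IHt.
suff : P (braid_under t).2 by rewrite braid_underE.
move=> k ek; have [i ei] := column_arc_surj inner_interior (Defs.over (t : crossing D)).1.
have [l el] := column_arc_surj inner_interior (under (t : crossing D)).1.
have Lc := row_lattice_crossing eq_bij inner_inj inner_interior rows ei el ek.
have yE : piece_color (braid_under t).2 =
    2 * piece_color (braid_over t).1 - piece_color (braid_under t).1.
  exact: piece_value_under.
have := row_latticeD (row_latticeD Lc (row_latticeZ 2 (Po i ei))) (row_latticeN (Pu l el)).
congr in_row_lattice; rewrite yE.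
by apply/matrixP=> a b; rewrite !mxE; ring.
Qed.

(** The row lattice is the orthogonal of two integer colorings, the constant one and
[piece_color]. *)
Lemma row_lattice_iff : exists y : 'I_(m + 2.*2) -> int,
  (forall j x, column_arc inner j = arc_of x -> y j = @piece_color w x) /\
  (forall v : 'rV_(m + 2.*2), L v <-> \sum_j v 0 j = 0 /\ \sum_j v 0 j * y j = 0).
Proof.
have [x_ xE] := fin_all_exists (column_arc_piece inner_interior).
pose y j := @piece_color w (x_ j).
have yE j x : column_arc inner j = arc_of x -> y j = @piece_color w x.
  by move=> jE; apply: piece_color_arc; rewrite -xE.
exists y; split=> // v; split=> [Lv|[v1 vy]].
  split.
    under eq_bigr do rewrite -[v _ _]mulr1.
    by apply: (row_lattice_sum rows (y := fun=> 1)) Lv.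
  apply: (row_lattice_sum rows (y := y)) Lv => [i j ij|c i j k iE jE kE].
    by rewrite (yE j (x_ j)) // (yE i (x_ j)) // ij.
  rewrite (yE _ _ iE) (yE _ _ jE) (yE _ _ kE).
  have -> : @piece_color w (under c).2 =
    2 * piece_color (braid_over c).1 - piece_color (braid_under c).1.
    exact: piece_value_under.
  by rewrite addrC subrK.
have [j0 E0] := column_arc_surj inner_interior ((ord0, inord 0) : piece D).
have [j1 E1] := column_arc_surj inner_interior ((ord0, inord 1) : piece D).
(* The coefficients of e_j0 and e_j1 in this sum cancel by v1 and vy. *)
have -> : v = \sum_j v 0 j *: (e_ j - (1 - y j) *: e_ j0 - y j *: e_ j1).
  rewrite {1}(row_sum_delta v).
  under [RHS]eq_bigr => j _.
    rewrite (_ : _ *: _ = v 0 j *: e_ j -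
      ((v 0 j - v 0 j * y j) *: e_ j0 + (v 0 j * y j) *: e_ j1)); last first.
      by apply/matrixP=> a b; rewrite !mxE; ring.
    over.
  rewrite [RHS]big_split /= sumrN big_split /= -!scaler_suml sumrB v1 vy.
  by rewrite subrr !scale0r addr0 subr0.
apply: (big_ind L); [exact: row_lattice0|exact: row_latticeD|move=> j _].
by apply: row_latticeZ; apply: row_lattice_color.
Qed.

End BraidLattice.

(** * The reduced matrix *)

(** The matrix attached to the fraction [p / q]. *)
Definition tangle_matrix (p q : int) : 'M[int]_(2, 2.*2) :=
  \matrix_(i < 2, j < 4) nth 0 (nth [::] [:: [:: 1; -1; 1; -1];
                                             [:: 0; p; - p - q; q]] i) j.

Lemma forall_ord4 (P : 'I_(2.*2) -> Prop) :
  P (@Ordinal 4 0 isT) -> P (@Ordinal 4 1 isT) -> P (@Ordinal 4 2 isT) ->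
  P (@Ordinal 4 3 isT) -> forall i, P i.
Proof.
move=> P0 P1 P2 P3 [[|[|[|[|//]]]] i4];
 [move: P0|move: P1|move: P2|move: P3]; congr P; exact: val_inj.
Qed.

Lemma sum_ord4 (F : 'I_(2.*2) -> int) : \sum_i F i =
  F (@Ordinal 4 0 isT) + F (@Ordinal 4 1 isT) + F (@Ordinal 4 2 isT) + F (@Ordinal 4 3 isT).
Proof.
rewrite !big_ord_recl big_ord0 addr0 !addrA.
by congr (F _ + F _ + F _ + F _); apply: val_inj.
Qed.

Lemma tangle_matrix_right_inv p q a b : a * p + b * q = 1 ->
  tangle_matrix p q *m (\matrix_(i < 2, j < 4) nth 0 (nth [::] [:: [:: 1; 0; 0; 0];
                                             [:: a + b; a; 0; b]] i) j)^T = 1%:M.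
Proof.
move=> ab; apply/matrixP=> i j; rewrite mxE sum_ord4 !mxE /=.
by case: i => -[|[|//]] ?; case: j => -[|[|//]] ? /=;
  first [ring | rewrite -[RHS]ab; ring].
Qed.

(** The vectors orthogonal to the all-one vector and to the endpoint colors are spanned
by the rows of [tangle_matrix p q]. *)
Lemma tangle_matrix_kernel p q P Q a b (v : 'rV[int]_(2.*2)) :
  a * p + b * q = 1 -> p * Q = q * P -> (P != 0) || (Q != 0) ->
  let y (j : 'I_(2.*2)) := nth 0 [:: 0; - P; Q - P; Q] j in
  \sum_j v 0 j = 0 -> \sum_j v 0 j * y j = 0 -> in_row_lattice (tangle_matrix p q) v.
Proof.
move=> ab pq PQ0 y; rewrite !sum_ord4 /y /=.
set v0 := v 0 _; set v1 := v 0 _; set v2 := v 0 _; set v3 := v 0 _ => sv syv.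
have v2E : v2 = - v0 - v1 - v3 by move: sv; lia.
have PvQ : (v3 + v0) * P = (v1 + v0) * Q.
  by apply/eqP; rewrite -subr_eq0 -syv v2E; apply/eqP; ring.
have pvq : (v3 + v0) * p = (v1 + v0) * q.
  case/orP: PQ0 => n0; apply: (mulIf n0).
    by rewrite mulrAC PvQ -!mulrA [Q * p]mulrC pq.
  by rewrite -mulrA pq [q * P]mulrC mulrA PvQ mulrAC.
(* Since p and q are coprime, (v1 + v0, v3 + v0) is a multiple k of (p, q). *)
pose k := a * (v1 + v0) + b * (v3 + v0).
have kp : k * p = v1 + v0.
  by rewrite mulrDl -[b * _ * p]mulrA pvq -[RHS]mulr1 -ab; ring.
have kq : k * q = v3 + v0.
  by rewrite mulrDl -[a * _ * q]mulrA -pvq -[RHS]mulr1 -ab; ring.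
exists (\row_(j < 2) nth 0 [:: v0; k] j).
apply/rowP; apply: forall_ord4; rewrite mxE !big_ord_recl big_ord0 !mxE /= -/v0 -/v1 -/v2 -/v3.
- ring.
- by rewrite kp; ring.
- by rewrite v2E mulrBr mulrN kp kq; ring.
- by rewrite kq; ring.
Qed.

Lemma is_coloring_matrix_reduction cs p q m (M : 'M[int]_(m + 2, m + 2.*2)) :
  odd (size cs) -> is_fraction_of cs p q ->
  is_coloring_matrix (rational_tangle cs) M ->
  d_U M = 1 /\ row_equivalent (M_l M) (tangle_matrix p q).
Proof.
move=> oddcs [cpq]; have cs0 : cs != [::] by case: (cs) oddcs.
rewrite -(convergents1 cs0) -convergents2.
have := final_color_rational cs; have := convergents_bezout cs.
case: (convergents cs) => Q P /=; rewrite oddcs => -[al [be albe]] [c0 c1 c2] pQ.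
move=> [eq [inner [eq_bij inner_inj inner_interior rows]]].
have [y [yE Liff]] := row_lattice_iff eq_bij inner_inj inner_interior rows.
have yend e : y (rshift m e) = nth 0 [:: 0; - P; Q - P; Q] e.
  rewrite (yE _ (braid_endpoint _ e)) ?column_arc_rshift // /piece_color.
  by move: e; apply: forall_ord4.
have [[a b] /= ab] := coprimezP _ _ cpq.
have PQ0 : (P != 0) || (Q != 0).
  by rewrite -negb_and; apply: contra_eqN albe => /andP[/eqP-> /eqP->]; rewrite !mulr0.
(* The colors of the columns, as affine combinations of the initial colors. *)
pose C := \matrix_(j < m + 2.*2, k < 2) (if k == 0 then 1 else y j).
have Ciff (v : 'rV[int]_(m + 2.*2)) : in_row_lattice M v <-> v *m C = 0.
  rewrite Liff; split=> [[v1 vy]|vC].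
    apply/rowP=> k; rewrite !mxE; case: (eqVneq k 0) => [k0|/negPf k0].
      by rewrite -[RHS]v1; apply: eq_bigr => j _; rewrite mxE k0 eqxx mulr1.
    by rewrite -[RHS]vy; apply: eq_bigr => j _; rewrite mxE k0.
  have E k : (v *m C) 0 k = 0 by rewrite vC mxE.
  split; [have := E 0|have := E 1]; rewrite mxE => {2}<-; apply: eq_bigr => j _;
    by rewrite mxE ?eqxx ?mulr1.
have CdE (j : 'I_(2.*2)) k : dsubmx C j k = if k == 0 then 1 else nth 0 [:: 0; - P; Q - P; Q] j.
  by rewrite !mxE yend.
pose T := tangle_matrix p q.
(* G writes the two initial colors in terms of those of the endpoints. *)
pose G : 'M[int]_(2, 2.*2) := \matrix_(i, j)
  nth 0 (nth [::] [:: [:: 1; 0; 0; 0]; [:: al - be; - al; 0; be]] i) j.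
have GC : G *m dsubmx C = 1%:M.
  apply/matrixP=> i k; rewrite mxE sum_ord4 !CdE !mxE.
  by case: i => -[|[|//]] ?; case: k => -[|[|//]] ? /=;
    first [ring | rewrite -[RHS]albe; ring].
have TC : T *m dsubmx C = 0.
  apply/matrixP=> i k; rewrite mxE sum_ord4 !CdE !mxE.
  case: i => -[|[|//]] ?; case: k => -[|[|//]] ? /=; try ring.
  by rewrite -[RHS](subrr (q * P)) -{2}pQ; ring.
(* Row i of [1, B] subtracts from the color of the interior arc i an equal
   combination of endpoint colors. *)
pose B := - (usubmx C *m G); pose N := block_mx 1%:M B 0 T.
have BC : B *m dsubmx C = - usubmx C by rewrite mulNmx -mulmxA GC mulmx1.
have NC : N *m C = 0.
  by rewrite -[C]vsubmxK mul_block_col mul1mx mul0mx BC TC subrr addr0 col_mx0.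
have [Z NZ] : exists Z, N = Z *m M.
  by apply: row_lattice_mull => i; apply/Ciff; rewrite -row_mul NC row0.
have [X MX] : exists X, M = X *m N.
  apply: row_lattice_mull => i; have /Ciff := row_lattice_row M i.
  rewrite -[row i M]hsubmxK; set v1 := lsubmx _; set v2 := rsubmx _.
  rewrite -[C]vsubmxK mul_row_col => vC.
  have [u uE] : in_row_lattice T (v2 - v1 *m B).
    have : (v2 - v1 *m B) *m dsubmx C = 0.
      by rewrite mulmxBl -mulmxA BC mulmxN opprK addrC.
    move: (v2 - _) => v vC0.
    have E k : (v *m dsubmx C) 0 k = 0 by rewrite vC0 mxE.
    apply: (tangle_matrix_kernel ab pQ PQ0).
      by rewrite -[RHS](E 0) [RHS]mxE; apply: eq_bigr => j _; rewrite CdE eqxx mulr1.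
    by rewrite -[RHS](E 1) [RHS]mxE; apply: eq_bigr => j _; rewrite CdE.
  exists (row_mx v1 u); rewrite mul_row_block mulmx1 mulmx0 addr0 -uE.
  by rewrite addrC subrK.
exact: standard_form_block MX NZ (tangle_matrix_right_inv ab).
Qed.

Theorem mainTheorem3 (cs : seq int) (p q : int) :
  odd (size cs) ->
  is_fraction_of cs p q ->
  (exists m (M : 'M[int]_(m + 2, m + 2.*2)),
     is_coloring_matrix (rational_tangle cs) M) /\
  (forall m (M : 'M[int]_(m + 2, m + 2.*2)),
     is_coloring_matrix (rational_tangle cs) M ->
     d_U M = 1 /\
     row_equivalent (M_l M)
       (\matrix_(i < 2, j < 4)
          nth 0 (nth [::] [:: [:: 1; -1; 1; -1];
                              [:: 0; p; - p - q; q]] i) j)).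
Proof.
move=> oddcs fr; split; first exact: exists_coloring_matrix.
by move=> m M; apply: is_coloring_matrix_reduction.
Qed.
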